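(* Let $N\ge1$ and let $f=|0,\dots,N-1|$, $g=|0,\dots,N-2,N|$, $h=|0,\dots,N-2,N+1|$, $s=|0,\dots,N-3,N-1,N|$ be Casoratians built from $\boldsymbol\psi$ (see context), regarded as functions of $(n,m,\alpha)$. Then (GD-4 (A-2) bilinear form) $$f(a\widetilde{\check f}+\widetilde{\check g})+(p-a)\widetilde f\check f-(pf+g)\widetilde{\check f}=0,\qquad f(a\widehat{\check f}+\widehat{\check g})+(q-a)\widehat f\check f-(qf+g)\widehat{\check f}=0,$$ $$f(a^2\widetilde{\check f}+a\widetilde{\check g}+\widetilde{\check s})-pf(a\widetilde{\check f}+\widetilde{\check g})+(p-a)\widetilde f(a\check f+\check g)-\widetilde{\check f}s=0,$$ $$f(a^2\widehat{\check f}+a\widehat{\check g}+\widehat{\check s})-qf(a\widehat{\check f}+\widehat{\check g})+(q-a)\widehat f(a\check f+\check g)-\widehat{\check f}s=0,$$ $$\widetilde f(pg+h)-\widetilde g(pf+g)+f\widetilde s=0,\qquad \widehat f(qg+h)-\widehat g(qf+g)+f\widehat s=0,$$ $$(p-q)(\widetilde f\widehat f-f\widehat{\widetilde f})+\widetilde f\widehat g-\widehat f\widetilde g=0,$$ $$\big[H(p,q)\widehat{\widetilde f}\check f+\widehat{\widetilde h}\check f-(p+q-\alpha_3)\widehat{\widetilde g}\check f+((p+q-\alpha_3)\widehat{\widetilde f}-\widehat{\widetilde g})(a\check f+\check g)+\widehat{\widetilde f}(a^2\check f+a\check g+\check s)\big](p-q)-p_a\widehat f\widetilde{\check f}+q_a\widetilde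 f\widehat{\check f}=0.$$
   Context: Fix $\alpha_1,\alpha_2,\alpha_3\in\mathbb C$, $G(\omega,k)=\omega^4-k^4+\alpha_3(\omega^3-k^3)+\alpha_2(\omega^2-k^2)+\alpha_1(\omega-k)$, $H(p,q)=p^2+pq+q^2-\alpha_3(p+q)+\alpha_2$. Let $p,q,a,b\in\mathbb C$ be pairwise distinct, and $p_a=G(-p,-a)/(p-a)$, $q_a=G(-q,-a)/(q-a)$. Fix $N\ge1$, $k_1,\dots,k_N\in\mathbb C$; for each $s$ let $\omega_1(k_s),\dots,\omega_4(k_s)$ be the four roots in $\omega$ of $G(-\omega,-k_s)=0$, with $\omega_4(k_s)=k_s$. For constants $\rho^{(0)}_{j,s}$ let $\psi_s(n,m,\alpha,\beta,l)=\sum_{j=1}^4\rho^{(0)}_{j,s}(-\omega_j(k_s))^l(p-\omega_j(k_s))^n(q-\omega_j(k_s))^m(a-\omega_j(k_s))^\alpha(b-\omega_j(k_s))^\beta$ and $\boldsymbol\psi(l)=(\psi_1,\dots,\psi_N)^T$. Casoratian notation: $|l_1,\dots,l_N|=\det(\boldsymbol\psi(l_1),\dots,\boldsymbol\psi(l_N))$; a run ''$0,\dots,j$'' with $j<0$ is empty, and if the listed indices number more than $N$ the symbol is $0$. Shifts: $\widetilde F=F(n+1,m,\alpha)$, $\widehat F=F(n,m+1,\alpha)$, $\check F=F(n,m,\alpha-1)$, compositions combine these (e.g. $\widetilde{\check f}=f(n+1,m,\alpha-1)$, $\widehat{\widetilde f}=f(n+1,m+1,\alpha)$). *)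

(* Defs.v *)
(* The complex field is modelled by an arbitrary
   numClosedFieldType C (e.g. complex R for R : realType, or algC). *)
From HB Require Import structures.
From mathcomp Require Import all_boot all_order all_algebra.
Set Implicit Arguments. Unset Strict Implicit. Unset Printing Implicit Defensive.
Import Order.TTheory GRing.Theory Num.Theory.
Local Open Scope ring_scope.

Section Defs.
Variable C : numClosedFieldType.

Definition Gdisp (a1 a2 a3 w k : C) : C :=
  w ^+ 4 - k ^+ 4 + a3 * (w ^+ 3 - k ^+ 3) + a2 * (w ^+ 2 - k ^+ 2)
  + a1 * (w - k).

Definition Hpq (a2 a3 p q : C) : C :=
  p ^+ 2 + p * q + q ^+ 2 - a3 * (p + q) + a2.

Definition psi (N : nat) (om : 'I_N -> 'I_4 -> C) (rho : 'I_4 -> 'I_N -> C)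
  (p q a b : C) (beta : int) (n m al : int) (l : nat) : 'cV[C]_N :=
  \col_(s < N) \sum_(j < 4)
     rho j s * (- om s j) ^+ l * (p - om s j) ^ n * (q - om s j) ^ m
       * (a - om s j) ^ al * (b - om s j) ^ beta.

Definition casor (N : nat) (v : nat -> 'cV[C]_N) (ls : seq nat) : C :=
  if size ls == N then \det (\matrix_(i < N, j < N) v (nth 0%N ls j) i 0)
  else 0.

End Defs.

(* index lists: f = |0..N-1|, g = |0..N-2,N|, h = |0..N-2,N+1|,
   s = |0..N-3,N-1,N|  (runs with negative upper end are empty) *)
Definition idx_f (N : nat) : seq nat := iota 0 N.
Definition idx_g (N : nat) : seq nat := iota 0 (N - 1) ++ [:: N].
Definition idx_h (N : nat) : seq nat := iota 0 (N - 1) ++ [:: N.+1].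
Definition idx_s (N : nat) : seq nat := iota 0 (N - 2) ++ [:: N - 1; N]%N.

(* Main.v *)
(* Every lattice shift replaces the columns psi(l) by y psi(l) + psi(l+1), so
   all Casoratians are determinants of sequences linked by such relations.
   Cramer's rule, sum_i (-1)^i |v_0 .. omit v_i .. v_N| v_i = 0, paired with a
   linear functional x |-> |w_0 .. w_(N-2), x|, yields each bilinear identity:
   the functional vanishes on most columns, up to a geometric term in (-y)^i,
   and the sum against (-y)^i rebuilds the Casoratian of the shifted sequence.
   For the last identity the functional is composed with the diagonal matrix of
   entries (p - q) G(-k_s, -a).  By the dispersion relation this matrix acts on
   psi as a polynomial in the shift l -> l+1, and dividing that polynomial by
   (E + a)(E + p)(E + q) with Lagrange interpolation produces p_a and q_a. *)
Require Import Defs.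
From HB Require Import structures.
From mathcomp Require Import all_boot all_order all_algebra.
From mathcomp Require Import perm ring.
Set Implicit Arguments.
Unset Strict Implicit.
Unset Printing Implicit Defensive.
Import Order.TTheory GRing.Theory Num.Theory.
Local Open Scope ring_scope.

(** * Column determinants over a commutative ring, and the abstract bilinear identities *)

Section Determinants.
Variable R : comNzRingType.
Implicit Types (x y : R).

Definition coldet N (c : nat -> 'cV[R]_N) : R :=
  \det (\matrix_(i < N, j < N) c j i 0).

Lemma eq_coldet N (c d : nat -> 'cV[R]_N) :
  (forall j, (j < N)%N -> c j = d j) -> coldet c = coldet d.
Proof. by move=> cd; congr (\det _); apply/matrixP=> i j; rewrite !mxE cd. Qed.

(** [d] is [c] times a unit bidiagonal matrix [T]. The multiplier may vary with the column, so that
    a single column can be left untouched. *)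
Lemma coldet_bidiag N (c d : nat -> 'cV[R]_N) (t : nat -> R) :
  (0 < N)%N -> d 0%N = c 0%N ->
  (forall j, (j.+1 < N)%N -> d j.+1 = c j.+1 + t j *: c j) ->
  coldet d = coldet c.
Proof.
move=> N_gt0 d0 dS.
pose T := \matrix_(i < N, j < N)
  ((i == j)%:R + (i.+1 == j)%:R * t i) : 'M[R]_N.
have detT : \det T = 1.
  rewrite -det_tr det_trig.
    by apply: big1 => i _; rewrite !mxE eqxx eqn_leq ltnn /= mul0r addr0.
  apply/is_trig_mxP => i j ij.
  rewrite !mxE -val_eqE /= !gtn_eqF ?mul0r ?addr0 //.
  exact: ltnW.
rewrite /coldet -[RHS]mulr1 -detT -det_mulmx; congr (\det _).
apply/matrixP => i j; rewrite !mxE.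
under eq_bigr => l _ do rewrite !mxE mulrDr.
rewrite big_split /= (bigD1 j) //= eqxx mulr1 big1 ?addr0; last first.
  by move=> l /negPf->; rewrite mulr0.
case: j => [[|j] ltj] /=.
  by rewrite d0 big1 ?addr0 // => l _; rewrite mul0r mulr0.
rewrite dS // !mxE (bigD1 (Ordinal (ltnW ltj))) //= eqxx mul1r mulrC.
rewrite big1 ?addr0 // => l; rewrite -val_eqE /= eqSS => /negPf->.
by rewrite mul0r mulr0.
Qed.

Variable n : nat.
Implicit Types (u v w : nat -> 'cV[R]_n.+1) (z : 'cV[R]_n.+1).

Definition with_last w z : nat -> 'cV[R]_n.+1 :=
  fun j => if j == n then z else w j.

Definition lastdet w z := coldet (with_last w z).

Lemma lastdet_self w : lastdet w (w n) = coldet w.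
Proof. by apply: eq_coldet => j _; rewrite /with_last; case: eqP => [->|]. Qed.

(** Filling the last slot with [0] makes the cofactors visibly independent of [z]; linearity in [z]
    follows. *)
Lemma lastdetE w z :
  lastdet w z =
  \sum_i z i 0 * cofactor (\matrix_(i, j) with_last w 0 j i 0) i ord_max.
Proof.
rewrite /lastdet /coldet (expand_det_col _ ord_max).
apply: eq_bigr => i _; rewrite !mxE /with_last eqxx; congr (_ * _).
rewrite /cofactor; congr (_ * \det _); apply/matrixP => a b; rewrite !mxE.
by rewrite lift_max ltn_eqF.
Qed.

Lemma lastdet_linear w x z z' :
  lastdet w (x *: z + z') = x * lastdet w z + lastdet w z'.
Proof.
rewrite !lastdetE mulr_sumr -big_split; apply: eq_bigr => i _ /=.
by rewrite !mxE mulrDl mulrA.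
Qed.

HB.instance Definition _ w :=
  GRing.isLinear.Build R 'cV[R]_n.+1 R^o _ (lastdet w) (lastdet_linear w).

Lemma lastdet_repeat w j : (j < n)%N -> lastdet w (w j) = 0.
Proof.
move=> ltj; rewrite /lastdet /coldet -det_tr.
have ltj' : (j < n.+1)%N by rewrite ltnW.
apply: (@determinant_alternate _ _ _ (Ordinal ltj') ord_max).
  by rewrite -val_eqE /= ltn_eqF.
by move=> i; rewrite !mxE /with_last /= eqxx ltn_eqF.
Qed.

(** Expansion along the column [z] gives the same minors on both sides; only the cofactor signs
    differ. *)
Lemma coldet_first w z :
  coldet (fun j => if j is j'.+1 then w j' else z) = (-1) ^+ n * lastdet w z.
Proof.
rewrite /lastdet /coldet (expand_det_col _ ord0) (expand_det_col _ ord_max).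
rewrite mulr_sumr; apply: eq_bigr => i _; rewrite !mxE /with_last eqxx /=.
rewrite [RHS]mulrCA; congr (_ * _); rewrite /cofactor [RHS]mulrA; congr (_ * _).
  by rewrite addn0 exprD mulrCA -expr2 sqrr_sign mulr1.
by congr (\det _); apply/matrixP => a b; rewrite !mxE lift0 lift_max ltn_eqF /=.
Qed.

(** With N = n+1, omitting n+1, n or n-1 (the last for n > 0) from 0, .., n+1 gives the Casoratians
    f, g and s. *)
Definition skipdet v i := coldet (v \o bump i).

(** Laplace expansion along an added top row [r]. A row already present gives Cramer's rule; a
    geometric row gives the Casoratian of a shifted sequence. *)
Lemma expand_skipdet v (r : nat -> R) :
  \det (\matrix_(i < n.+2, j < n.+2)
          (if unlift ord0 i is Some i' then v j i' 0 else r j)) =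
  \sum_(i < n.+2) (-1) ^+ i * skipdet v i * r i.
Proof.
rewrite (expand_det_row _ ord0); apply: eq_bigr => i _.
rewrite !mxE unlift_none mulrC; congr (_ * _); rewrite /cofactor add0n.
by congr (_ * \det _); apply/matrixP => a b; rewrite !mxE liftK.
Qed.

Lemma cramer v (phi : {linear 'cV[R]_n.+1 -> R^o}) :
  \sum_(i < n.+2) (-1) ^+ i * skipdet v i * phi (v i) = 0.
Proof.
suff v0 : \sum_(i < n.+2) ((-1) ^+ i * skipdet v i) *: v i = 0.
  rewrite -[RHS](linear0 phi) -v0 linear_sum; apply: eq_bigr => i _.
  by rewrite linearZ.
apply/colP => k; rewrite summxE mxE.
under eq_bigr => i _ do rewrite mxE.
(* The top row now repeats the k-th coordinate row, so the determinant vanishes. *)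
rewrite -(expand_skipdet v (fun i => v i k 0)).
apply: (@determinant_alternate _ _ _ ord0 (lift ord0 k)) => // j.
by rewrite !mxE unlift_none liftK.
Qed.

Definition shifted y u v := forall l, v l = y *: u l + u l.+1.

(* Prepending the row [(- y) ^+ j] to [u] makes the column operations that
   build [v] clear this row except for its first entry. *)
Lemma coldet_shifted y u v :
  shifted y u v ->
  coldet v = \sum_(i < n.+2) (-1) ^+ i * skipdet u i * (- y) ^+ i.
Proof.
move=> uv; rewrite -(expand_skipdet u (fun i => (- y) ^+ i)).
pose ext (c : nat -> 'cV[R]_n.+1) (r : nat -> R) (j : nat) : 'cV[R]_n.+2 :=
  \col_i (if unlift ord0 i is Some i' then c j i' 0 else r j).
transitivity (coldet (ext u (fun i => (- y) ^+ i))); last first.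
  by congr (\det _); apply/matrixP => i j; rewrite !mxE.
pose v' j := if j is j'.+1 then v j' else u 0%N.
rewrite -(@coldet_bidiag _ _ (ext v' (fun j => (j == 0%N)%:R)) (fun=> y)) //.
- rewrite /coldet [RHS](expand_det_row _ ord0) [RHS](bigD1 ord0) //=.
  rewrite big1 ?addr0.
    rewrite !mxE unlift_none eqxx mul1r /cofactor expr0 mul1r; congr (\det _).
    by apply/matrixP => a b; rewrite !mxE liftK.
  by move=> j; rewrite !mxE unlift_none -val_eqE /= => /negPf->; rewrite mul0r.
- move=> j _; apply/colP => i; rewrite !mxE.
  case: unliftP => [i' _|_] /=; first by rewrite uv !mxE addrC.
  by rewrite exprS mulNr addrC subrr.
Qed.

Lemma skipdet_max v : skipdet v n.+1 = coldet v.
Proof. by apply: eq_coldet => j ltj; rewrite /= /bump leqNgt ltj. Qed.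

Lemma skipdetE v : skipdet v n = lastdet v (v n.+1).
Proof.
apply: eq_coldet => j; rewrite /with_last ltnS /= /bump.
by case: ltngtP => // ->.
Qed.

(** Moved to the front, [u 0] is followed by [v 0, .., v n.-1], and unit column operations turn this
    into [u 0, .., u n]. *)
Lemma lastdet_shift0 y u v :
  shifted y u v -> lastdet v (u 0%N) = (-1) ^+ n * coldet u.
Proof.
move=> uv; apply: (can_inj (signrMK n)).
rewrite signrMK -coldet_first; apply: coldet_bidiag => // j _.
by rewrite uv addrC.
Qed.

(** The recursion [u i.+1 = - y *: u i + v i] is geometric as long as the functional kills [v i],
    that is for [i < n]; at [i = n] it contributes [coldet v]. *)
Lemma lastdet_shift y u v i :
  shifted y u v -> (i <= n.+1)%N ->
  lastdet v (u i) =
  (-1) ^+ n * coldet u * (- y) ^+ i + (i == n.+1)%:R * coldet v.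
Proof.
move=> uv; elim: i => [|i IHi] lei.
  by rewrite (lastdet_shift0 uv) mulr1 mul0r addr0.
have -> : u i.+1 = (- y) *: u i + v i by rewrite uv scaleNr addKr.
rewrite lastdet_linear IHi 1?ltnW // (ltn_eqF lei) mul0r addr0 exprS mulrCA.
rewrite eqSS; case: eqP => [->|/eqP ni]; first by rewrite lastdet_self mul1r.
by rewrite mul0r lastdet_repeat // ltn_neqAle ni.
Qed.

(* The factor [(0 < n)%:R] makes the symbol [0] for a single column, where
   the list [0, .., N-3, N-1, N] is too long. *)
Definition penultdet v := (0 < n)%:R * skipdet v n.-1.

Lemma sum_shifted y v (f : nat -> 'cV[R]_n.+1) x :
  shifted y v f ->
  \sum_(i < n.+2) (-1) ^+ i * skipdet v i * (x * (- y) ^+ i) = x * coldet f.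
Proof.
move=> vf; rewrite (coldet_shifted vf) mulr_sumr; apply: eq_bigr => i _.
by rewrite mulrCA.
Qed.

(** In Cramer's relation the remainder [t] survives only at n-1, n and n+1, where the minors of [v]
    are s, g and f. *)
Lemma cramer_remainder v (phi : {linear 'cV[R]_n.+1 -> R^o}) (r t : nat -> R) :
  (forall i, (i <= n.+1)%N -> phi (v i) = (-1) ^+ n * r i + t i) ->
  (forall i, (i.+1 < n)%N -> t i = 0) ->
  \sum_(i < n.+2) (-1) ^+ i * skipdet v i * r i =
  t n.+1 * coldet v - t n * skipdet v n + t n.-1 * penultdet v.
Proof.
move=> phiE t0; have sum_lt k (F : nat -> R) :
    (forall i, (i.+1 < k)%N -> F i = 0) ->
    \sum_(i < k) F i = (0 < k)%:R * F k.-1.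
  case: k => [|k] F0; first by rewrite big_ord0 mul0r.
  rewrite big_ord_recr big1 /= ?mul1r ?add0r // => i _.
  by rewrite F0 // ltnS.
(* The sign flips only for n > 0, since [0.-1 = 0]; the guarding factor covers n = 0. *)
have sgn : (0 < n)%:R * (-1) ^+ n.-1 = - ((0 < n)%:R * (-1) ^+ n) :> R.
  by case: (n) => [|n'] /=; rewrite ?mul0r ?oppr0 // exprS; ring.
apply: (can_inj (signrMK n)); rewrite mulr_sumr.
have := cramer v phi; under eq_bigr => i _ do
  rewrite (phiE i (ltn_ord i)) mulrDr.
rewrite big_split /=; under eq_bigr => i _ do rewrite mulrCA.
move=> /eqP; rewrite addr_eq0 => /eqP ->.
rewrite !big_ord_recr /= (sum_lt _ (fun i => (-1) ^+ i * skipdet v i * t i));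
  last by move=> i ?; rewrite t0 ?mulr0.
rewrite skipdet_max exprS /penultdet !mulrA sgn; ring.
Qed.

(** The sequences sit at the corners of a lattice square. Since [v i = (x - y) *: u i + w i], the
    functional [lastdet w] is geometric in [- y] on [v], up to terms at n and n+1. *)
Lemma bilinear_cross x y u v w f :
  shifted x u v -> shifted y u w -> shifted y v f ->
  (x - y) * coldet f * coldet u
  - coldet v * ((x - y) * coldet w + skipdet w n)
  + skipdet v n * coldet w = 0.
Proof.
move=> uv uw vf.
pose t i := (i == n.+1)%:R * ((x - y) * coldet w) + lastdet w (w i).
have t0 i : (i < n)%N -> t i = 0.
  move=> lti; rewrite /t lastdet_repeat // addr0 ltn_eqF ?mul0r //.
  by rewrite ltnS ltnW.
have vE i : (i <= n.+1)%N ->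
    lastdet w (v i) = (-1) ^+ n * ((x - y) * coldet u * (- y) ^+ i) + t i.
  move=> lei; have -> : v i = (x - y) *: u i + w i.
    by rewrite uv uw addrA -scalerDl subrK.
  rewrite lastdet_linear (lastdet_shift uw lei) /t; ring.
have := cramer_remainder vE (fun i lti => t0 i (ltnW lti)).
have -> : t n.-1 * penultdet v = 0.
  rewrite /penultdet; case: posnP => [_|n_gt0]; first by rewrite mul0r mulr0.
  by rewrite t0 ?mul0r // prednK.
rewrite (sum_shifted _ vf) /t lastdet_self -skipdetE eqxx ltn_eqF // => E.
rewrite mul1r mul0r add0r in E.
by rewrite -(subrr ((x - y) * coldet u * coldet f)) {2}E; ring.
Qed.

(** Applied to [v i = x *: u i + u i.+1], the functional [lastdet u] has no geometric part; its
    value at n+1 brings in the Casoratian h of [u]. *)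
Lemma bilinear_hook x u v :
  shifted x u v ->
  coldet v * (x * skipdet u n + lastdet u (u n.+2))
  - skipdet v n * (x * coldet u + skipdet u n) + coldet u * penultdet v = 0.
Proof.
move=> uv; pose t i := x * lastdet u (u i) + lastdet u (u i.+1).
have t0 i : (i.+1 < n)%N -> t i = 0.
  by move=> lti; rewrite /t !lastdet_repeat ?mulr0 ?addr0 // ltnW.
have vE i : (i <= n.+1)%N -> lastdet u (v i) = (-1) ^+ n * 0 + t i.
  by move=> _; rewrite uv lastdet_linear mulr0 add0r.
have := cramer_remainder vE t0.
under eq_bigr do rewrite mulr0.
rewrite big1_eq /t -!skipdetE !lastdet_self.
have -> : (x * lastdet u (u n.-1) + lastdet u (u n.-1.+1)) * penultdet v
    = coldet u * penultdet v.
  rewrite /penultdet; case: posnP => [_|n_gt0]; first by rewrite mul0r !mulr0.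
  by rewrite prednK // lastdet_self lastdet_repeat ?prednK // mulr0 add0r.
by move=> E; rewrite [RHS]E; ring.
Qed.

(** [w \o bump n.-1] has [w n] in slot [n.-1], so putting [w n.-1] last amounts to transposing the
    last two columns. *)
Lemma lastdet_swap w :
  (0 < n)%N -> lastdet (w \o bump n.-1) (w n.-1) = - coldet w.
Proof.
move=> n_gt0; have lt_pred : (n.-1 < n.+1)%N by rewrite ltnS leq_pred.
pose k := Ordinal lt_pred.
rewrite /coldet -mulN1r -[_ * _]mulrC.
have -> : -1 = \det (tperm_mx k ord_max) :> R.
  rewrite det_perm odd_tperm -val_eqE /= ltn_eqF ?expr1 //.
  by rewrite prednK.
rewrite -det_mulmx -xcolE; congr (\det _); apply/matrixP => i j.
rewrite !mxE /with_last /= /bump.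
case: tpermP => [->|->|/eqP jk /eqP jn] /=.
- by rewrite ltn_eqF ?prednK // leqnn add1n prednK.
- by rewrite eqxx.
- have ltj : (j < n)%N by rewrite ltn_neqAle -ltnS ltn_ord andbT.
  rewrite ltn_eqF // leqNgt ltn_neqAle [X in X && _]jk /=.
  by rewrite -ltnS prednK // ltj.
Qed.

Lemma coldet_shifted_size1 y v f :
  n = 0%N -> shifted y v f -> coldet f = skipdet v n + y * coldet v.
Proof.
move=> n0 vf; rewrite (coldet_shifted vf) !big_ord_recr /= big1.
  have expn e : e ^+ n = 1 :> R by rewrite n0.
  by rewrite skipdet_max !exprS !expn; ring.
by move=> i _; have := ltn_ord i; rewrite [X in (_ < X)%N]n0.
Qed.

Lemma bilinear_penult x y u v w f :
  shifted x u v -> shifted y u w -> shifted y v f ->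
  coldet v * (x ^+ 2 * coldet w + x * skipdet w n + penultdet w)
  - y * coldet v * (x * coldet w + skipdet w n)
  + (y - x) * coldet f * (x * coldet u + skipdet u n)
  - coldet w * penultdet v = 0.
Proof.
move=> uv uw vf; have cross := bilinear_cross uv uw vf.
(* [core] is what Cramer's rule gives for n > 0; the claim is minus [core] minus [(x - y)] times
   [cross]. *)
suff core : (x - y) * coldet f * (y * coldet u + skipdet u n)
    - (x - y) * coldet w * skipdet v n
    - coldet v * ((x - y) * y * coldet w + penultdet w)
    + coldet w * penultdet v = 0.
  rewrite -[RHS]oppr0 -[in RHS]core -[LHS]addr0 -(mulr0 (x - y)).
  by rewrite -[in LHS]cross; ring.
case: (posnP n) => [n0|n_gt0].
  rewrite /penultdet [(0 < n)%N]lt0n [n == 0%N](introT eqP n0).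
  rewrite (coldet_shifted_size1 n0 vf).
  by rewrite (coldet_shifted_size1 n0 uw) /=; ring.
(* Leaving the slot of [w n.-1] free keeps both [coldet w] and [penultdet w]
   among the values of the functional. *)
pose W := w \o bump n.-1; pose c0 := y * coldet u + skipdet u n.
have repeat i : (i.+1 < n)%N -> lastdet W (w i) = 0.
  move=> lti; have -> : w i = W i.
    by rewrite /W /= /bump leqNgt -ltnS prednK // lti.
  by rewrite lastdet_repeat // ltnW.
have w_n : lastdet W (w n) = 0.
  have -> : w n = W n.-1 by rewrite /W /= /bump leqnn add1n prednK.
  by rewrite lastdet_repeat // prednK.
have w_n1 : lastdet W (w n.+1) = penultdet w.
  rewrite /penultdet n_gt0 mul1r; apply: eq_coldet => j; rewrite /with_last /=.
  rewrite ltnS leq_eqVlt => /predU1P[->|ltj]; last by rewrite ltn_eqF.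
  by rewrite eqxx /bump leq_pred.
have u_0 : lastdet W (u 0%N) = (-1) ^+ n * c0.
  apply: (can_inj (signrMK n)); rewrite signrMK -coldet_first.
  have -> : c0 = lastdet u (w n).
    by rewrite /c0 uw lastdet_linear lastdet_self skipdetE.
  (* The last column is [w n] on both sides, hence the multiplier 0 there; the others are
     [w j = y *: u j + u j.+1]. *)
  apply: (@coldet_bidiag _ _ _ (fun j => if j.+1 == n then 0 else y)) => //.
    by rewrite /with_last ltn_eqF.
  move=> j; rewrite ltnS => ltj; rewrite /with_last /W /= /bump.
  rewrite -ltnS prednK // [(j == n)]ltn_eqF //.
  case: eqP => [jn|/eqP jn].
    have -> : (n <= j.+1)%N by rewrite jn.
    by rewrite scale0r addr0 add1n jn.
  by rewrite leqNgt ltn_neqAle jn ltj uw addrC.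
(* Among [w 0, .., w n] the functional sees only [w n.-1], with value [- coldet w]; this enters at
   [u n] and is multiplied by [- y] at [u n.+1]. *)
have lastdet_u i : (i <= n.+1)%N -> lastdet W (u i) =
    (-1) ^+ n * c0 * (- y) ^+ i
    + ((i == n.+1)%:R * y - (i == n)%:R) * coldet w.
  elim: i => [|i IHi] lei.
    by rewrite u_0 mulr1 (ltn_eqF n_gt0) !mul0r subrr mul0r addr0.
  have -> : u i.+1 = (- y) *: u i + w i by rewrite uw scaleNr addKr.
  rewrite lastdet_linear IHi 1?ltnW // (ltn_eqF lei) !eqSS exprS.
  case: (ltngtP i.+1 n) => [lti|lti|ein].
  - by rewrite repeat // !ltn_eqF //=; [ring | exact: ltnW].
  - have -> : i = n by apply/eqP; rewrite eqn_leq -ltnS lei.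
    rewrite w_n eqxx /=; ring.
  - have -> : i = n.-1 by rewrite -ein.
    rewrite lastdet_swap // !ltn_eqF ?prednK //=.
    ring.
pose t i := (x - y) * (((i == n.+1)%:R * y - (i == n)%:R) * coldet w)
  + lastdet W (w i).
have t0 i : (i.+1 < n)%N -> t i = 0.
  move=> lti; rewrite /t repeat // !ltn_eqF /=; first by ring.
    by rewrite ltnW.
  by rewrite ltnS; apply/ltnW/ltnW.
have vE i : (i <= n.+1)%N ->
    lastdet W (v i) = (-1) ^+ n * ((x - y) * c0 * (- y) ^+ i) + t i.
  move=> lei; have -> : v i = (x - y) *: u i + w i.
    by rewrite uv uw addrA -scalerDl subrK.
  rewrite lastdet_linear (lastdet_u _ lei) /t; ring.
have := cramer_remainder vE t0.
rewrite (sum_shifted _ vf) /t w_n w_n1 lastdet_swap // !eqxx.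
have -> : (n.+1 == n) = false by rewrite gtn_eqF.
have -> : (n == n.+1) = false by rewrite ltn_eqF.
have -> : (n.-1 == n.+1) = false by rewrite ltn_eqF // ltnS leq_pred.
have -> : (n.-1 == n) = false by rewrite ltn_eqF // prednK.
move=> E; rewrite -(subrr ((x - y) * c0 * coldet f)) {2}E /c0 /=.
ring.
Qed.

(** The functional is [lastdet v] after [M]. On [wq] and [wp] it is geometric in [- p] and [- q],
    and summing against the minors of [u] rebuilds [coldet up] and [coldet uq]. *)
Lemma bilinear_dispersion p q k c cp cq (M : 'M[R]_n.+1) u up uq wp wq v :
  shifted p u up -> shifted q u uq ->
  shifted q wp v -> shifted p wq v ->
  (forall l, M *m u l =
     k *: (v l.+1 + c *: v l) + (cp *: wq l - cq *: wp l)) ->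
  k * ((lastdet v (v n.+2) + c * skipdet v n) * coldet u
       - (skipdet v n + c * coldet v) * skipdet u n
       + coldet v * penultdet u)
  + (cp - cq) * coldet v * coldet u
  - cp * coldet wq * coldet up + cq * coldet wp * coldet uq = 0.
Proof.
move=> u_up u_uq wp_v wq_v Mu.
pose t i := k * (lastdet v (v i.+1) + c * lastdet v (v i))
  + (i == n.+1)%:R * ((cp - cq) * coldet v).
have t0 i : (i.+1 < n)%N -> t i = 0.
  move=> lti; rewrite /t !lastdet_repeat ?ltn_eqF //=; first by ring.
    by rewrite ltnS; apply/ltnW/ltnW.
  exact: ltnW.
pose r i := cp * coldet wq * (- p) ^+ i - cq * coldet wp * (- q) ^+ i.
have vD z z' : lastdet v (z + z') = lastdet v z + lastdet v z'.
  exact: linearD.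
have vZ x z : lastdet v (x *: z) = x * lastdet v z by exact: linearZ.
have uE i : (i <= n.+1)%N ->
    (lastdet v \o mulmx M) (u i) = (-1) ^+ n * r i + t i.
  move=> lei /=; rewrite Mu -scaleNr !(vD, vZ).
  rewrite (lastdet_shift wp_v lei) (lastdet_shift wq_v lei) /r /t.
  ring.
have := cramer_remainder uE t0.
under eq_bigr do rewrite mulrBr.
rewrite sumrB (sum_shifted _ u_up) (sum_shifted _ u_uq).
have -> : t n.-1 * penultdet u = k * coldet v * penultdet u.
  rewrite /penultdet /t; case: posnP => [_|n_gt0].
    by rewrite mul0r !mulr0.
  rewrite prednK // lastdet_self lastdet_repeat ?prednK //.
  by rewrite ltn_eqF ?prednK //=; ring.
rewrite /t -!skipdetE lastdet_self eqxx (ltn_eqF (ltnSn n)) => E.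
rewrite -(subrr (cp * coldet wq * coldet up - cq * coldet wp * coldet uq)).
by rewrite {1}E /=; ring.
Qed.

End Determinants.

(** * Translation of the Casoratians f, g, h, s into column determinants *)

Section Casoratians.
Variables (C : numClosedFieldType) (n : nat).
Implicit Types v : nat -> 'cV[C]_n.+1.

Lemma casorE v ls :
  size ls = n.+1 -> casor v ls = coldet (fun j => v (nth 0%N ls j)).
Proof. by move=> ls_n; rewrite /casor ls_n eqxx. Qed.

Lemma casor_f v : casor v (idx_f n.+1) = coldet v.
Proof.
rewrite casorE ?size_iota //; apply: eq_coldet => j ltj.
by rewrite nth_iota.
Qed.

Lemma nth_run_last x j :
  (j < n.+1)%N -> nth 0%N (iota 0 n ++ [:: x]) j = if j == n then x else j.
Proof.
rewrite ltnS nth_cat size_iota leq_eqVlt => /predU1P[->|ltj].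
  by rewrite ltnn subnn eqxx.
by rewrite ltj nth_iota // ltn_eqF.
Qed.

Lemma casor_run_last v x :
  casor v (iota 0 (n.+1 - 1) ++ [:: x]) = lastdet v (v x).
Proof.
rewrite subn1 casorE ?size_cat ?size_iota ?addn1 //.
by apply: eq_coldet => j ltj; rewrite nth_run_last // /with_last; case: eqP.
Qed.

Lemma casor_g v : casor v (idx_g n.+1) = skipdet v n.
Proof. by rewrite skipdetE casor_run_last. Qed.

Lemma casor_h v : casor v (idx_h n.+1) = lastdet v (v n.+2).
Proof. exact: casor_run_last. Qed.

Lemma casor_s v : casor v (idx_s n.+1) = penultdet v.
Proof.
rewrite /penultdet /idx_s subn1; case: posnP => [n0|n_gt0].
  (* For N = 1 the list has two entries, so [casor] takes its default value 0. *)
  by rewrite mul0r /casor ifN // size_cat size_iota n0.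
have -> : (n.+1 - 2 = n.-1)%N by rewrite subSS subn1.
rewrite mul1r casorE ?size_cat ?size_iota /= ?addn2 ?prednK //.
apply: eq_coldet => j; rewrite ltnS nth_cat size_iota /= /bump => lej.
case: ltnP => [ltj|gej]; first by rewrite nth_iota.
have [->|jn] := eqVneq j n.
  have -> : (n - n.-1 = 1)%N by rewrite -{1}(prednK n_gt0) subSnn.
  by rewrite add1n.
have -> : j = n.-1.
  by apply/eqP; rewrite eqn_leq gej andbT -ltnS prednK // ltn_neqAle jn.
by rewrite subnn add1n prednK.
Qed.

End Casoratians.

(** * Lattice shifts of psi and the dispersion relation *)

Section Lattice.
Variables (C : numClosedFieldType) (N : nat).
Variables (om : 'I_N.+1 -> 'I_4 -> C) (rho : 'I_4 -> 'I_N.+1 -> C).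
Variables (p q a b : C) (beta : int).
Hypothesis om_reg : forall s j,
  [/\ p - om s j != 0, q - om s j != 0, a - om s j != 0 & b - om s j != 0].

Local Notation psi := (psi om rho p q a b beta).

Lemma shifted_n n m al : shifted p (psi n m al) (psi (n + 1) m al).
Proof.
move=> l; apply/colP => s; rewrite !mxE mulr_sumr -big_split.
apply: eq_bigr => j _ /=; have [p_om _ _ _] := om_reg s j.
by rewrite expfzDr // expr1z exprS; ring.
Qed.

Lemma shifted_m n m al : shifted q (psi n m al) (psi n (m + 1) al).
Proof.
move=> l; apply/colP => s; rewrite !mxE mulr_sumr -big_split.
apply: eq_bigr => j _ /=; have [_ q_om _ _] := om_reg s j.
by rewrite expfzDr // expr1z exprS; ring.
Qed.

Lemma shifted_al n m al : shifted a (psi n m (al - 1)) (psi n m al).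
Proof.
move=> l; apply/colP => s; rewrite !mxE mulr_sumr -big_split.
apply: eq_bigr => j _ /=; have [_ _ a_om _] := om_reg s j.
rewrite -{1}[al](subrK 1) expfzDr // expr1z exprS; ring.
Qed.

(** Put E = -w for a root w. The cubic G(E,-a)/(E+a) has E^2 coefficient a3 - a, so division by
    (E+p)(E+q) has quotient E + a3 - a - p - q. The linear remainder takes the values -p_a and -q_a
    at -p and -q. The entry G(-k_s,-a) is common to the four roots, so a diagonal matrix
    suffices. *)
Lemma dispersion a1 a2 a3 (k : 'I_N.+1 -> C) n m al l :
  p != a -> q != a ->
  (forall s j, Gdisp a1 a2 a3 (- om s j) (- k s) = 0) ->
  diag_mx (\row_s ((p - q) * Gdisp a1 a2 a3 (- k s) (- a)))
    *m psi n m (al - 1) l =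
  (p - q) *: (psi (n + 1) (m + 1) al l.+1
              + (a3 - a - p - q) *: psi (n + 1) (m + 1) al l)
  + ((Gdisp a1 a2 a3 (- p) (- a) / (p - a)) *: psi n (m + 1) al l
     - (Gdisp a1 a2 a3 (- q) (- a) / (q - a)) *: psi (n + 1) m al l).
Proof.
rewrite -(subr_eq0 p) -(subr_eq0 q) => pa0 qa0 root.
apply/colP => s; rewrite mul_diag_mx !mxE !mulr_sumr -!sumrN -!big_split /=.
rewrite mulr_sumr -!big_split /=; apply: eq_bigr => j _.
have [p_om q_om a_om _] := om_reg s j; have := root s j.
have alE : (a - om s j) ^ al = (a - om s j) ^ (al - 1) * (a - om s j).
  by rewrite -{1}[al](subrK 1) expfzDr // expr1z.
rewrite alE !(expfzDr n) // !(expfzDr m) // !expr1z !exprS.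
set w := om s j; set P := (p - w) ^ n; set Q := (q - w) ^ m.
set A := (a - w) ^ (al - 1); set B := (b - w) ^ beta; set L := (- w) ^+ l.
move=> Gw.
(* G is the difference of one quartic at two arguments, hence telescopes through -w. *)
have -> : Gdisp a1 a2 a3 (- k s) (- a)
    = Gdisp a1 a2 a3 (- w) (- a) - Gdisp a1 a2 a3 (- w) (- k s).
  by rewrite /Gdisp; ring.
rewrite Gw subr0 /Gdisp; field.
by rewrite pa0 qa0.
Qed.

End Lattice.

Theorem theorem4p1 (C : numClosedFieldType) (a1 a2 a3 p q a b : C)
  (N : nat) (k : 'I_N -> C) (om : 'I_N -> 'I_4 -> C)
  (rho : 'I_4 -> 'I_N -> C) (beta : int) :
  (0 < N)%N ->
  p != q -> p != a -> p != b -> q != a -> q != b -> a != b ->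
  (forall s : 'I_N, om s ord_max = k s) ->
  (forall (s : 'I_N) (w : C),
      Gdisp a1 a2 a3 (- w) (- k s) = \prod_(j < 4) (w - om s j)) ->
  (forall (s : 'I_N) (j : 'I_4),
      [/\ p - om s j != 0, q - om s j != 0, a - om s j != 0
        & b - om s j != 0]) ->
  let F ls (n m al : int) := casor (psi om rho p q a b beta n m al) ls in
  let f := F (idx_f N) in
  let g := F (idx_g N) in
  let h := F (idx_h N) in
  let s := F (idx_s N) in
  let pa := Gdisp a1 a2 a3 (- p) (- a) / (p - a) in
  let qa := Gdisp a1 a2 a3 (- q) (- a) / (q - a) in
  forall n m al : int,
  (f n m al * (a * f (n+1) m (al-1) + g (n+1) m (al-1))
        + (p - a) * f (n+1) m al * f n m (al-1)
        - (p * f n m al + g n m al) * f (n+1) m (al-1) = 0) /\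
  (      f n m al * (a * f n (m+1) (al-1) + g n (m+1) (al-1))
        + (q - a) * f n (m+1) al * f n m (al-1)
        - (q * f n m al + g n m al) * f n (m+1) (al-1) = 0) /\
  (      f n m al * (a ^+ 2 * f (n+1) m (al-1) + a * g (n+1) m (al-1)
                   + s (n+1) m (al-1))
        - p * f n m al * (a * f (n+1) m (al-1) + g (n+1) m (al-1))
        + (p - a) * f (n+1) m al * (a * f n m (al-1) + g n m (al-1))
        - f (n+1) m (al-1) * s n m al = 0) /\
  (      f n m al * (a ^+ 2 * f n (m+1) (al-1) + a * g n (m+1) (al-1)
                   + s n (m+1) (al-1))
        - q * f n m al * (a * f n (m+1) (al-1) + g n (m+1) (al-1))
        + (q - a) * f n (m+1) al * (a * f n m (al-1) + g n m (al-1))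
        - f n (m+1) (al-1) * s n m al = 0) /\
  (      f (n+1) m al * (p * g n m al + h n m al)
        - g (n+1) m al * (p * f n m al + g n m al)
        + f n m al * s (n+1) m al = 0) /\
  (      f n (m+1) al * (q * g n m al + h n m al)
        - g n (m+1) al * (q * f n m al + g n m al)
        + f n m al * s n (m+1) al = 0) /\
  (      (p - q) * (f (n+1) m al * f n (m+1) al - f n m al * f (n+1) (m+1) al)
        + f (n+1) m al * g n (m+1) al - f n (m+1) al * g (n+1) m al = 0) /\
  ((Hpq a2 a3 p q * f (n+1) (m+1) al * f n m (al-1)
        + h (n+1) (m+1) al * f n m (al-1)
        - (p + q - a3) * g (n+1) (m+1) al * f n m (al-1)
        + ((p + q - a3) * f (n+1) (m+1) al - g (n+1) (m+1) al)
            * (a * f n m (al-1) + g n m (al-1))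
        + f (n+1) (m+1) al
            * (a ^+ 2 * f n m (al-1) + a * g n m (al-1) + s n m (al-1)))
        * (p - q)
      - pa * f n (m+1) al * f (n+1) m (al-1)
      + qa * f (n+1) m al * f n (m+1) (al-1) = 0).
Proof.
case: N k om rho => // N' k om rho _ _ pa _ qa _ _ _ Gom om_reg.
move=> F f g h s p_a q_a n m al.
have root i j : Gdisp a1 a2 a3 (- om i j) (- k i) = 0.
  by rewrite Gom (bigD1 j) //= subrr mul0r.
rewrite /f /g /h /s /F !casor_f !casor_g !casor_h !casor_s.
have Sn n' m' al' := @shifted_n _ _ om rho p q a b beta om_reg n' m' al'.
have Sm n' m' al' := @shifted_m _ _ om rho p q a b beta om_reg n' m' al'.
have Sa n' m' al' := @shifted_al _ _ om rho p q a b beta om_reg n' m' al'.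
(* Here the square is spanned by the alpha direction, with x = a, and by n or m, with y = p or q. *)
have Dn := bilinear_cross (Sa n m al) (Sn n m (al - 1)) (Sn n m al).
have Dm := bilinear_cross (Sa n m al) (Sm n m (al - 1)) (Sm n m al).
have Pn := bilinear_penult (Sa n m al) (Sn n m (al - 1)) (Sn n m al).
have Pm := bilinear_penult (Sa n m al) (Sm n m (al - 1)) (Sm n m al).
split; first by rewrite -[RHS]oppr0 -[in RHS]Dn; ring.
split; first by rewrite -[RHS]oppr0 -[in RHS]Dm; ring.
split; first exact: Pn.
split; first exact: Pm.
split; first exact: bilinear_hook (Sn n m al).
split; first exact: bilinear_hook (Sm n m al).
split.
  have := bilinear_cross (Sn n m al) (Sm n m al) (Sm (n + 1) m al).
  by move=> E; rewrite -[RHS]oppr0 -[in RHS]E; ring.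
have := bilinear_dispersion (Sn n m (al - 1)) (Sm n m (al - 1))
  (Sm (n + 1) m al) (Sn n (m + 1) al)
  (fun l => dispersion rho beta om_reg n m al l pa qa root).
rewrite -/p_a -/q_a => E; rewrite -[RHS]E.
(* This difference, the coefficient produced by the top index of the remainder, accounts for H(p,q)
   and for the terms in a of the product of the doubly shifted f with the alpha-shifted f. *)
have -> : p_a - q_a = (p - q) * (Hpq a2 a3 p q + a * (p + q - a3) + a ^+ 2).
  move: pa qa; rewrite -(subr_eq0 p) -(subr_eq0 q) => pa0 qa0.
  by rewrite /p_a /q_a /Gdisp /Hpq; field; rewrite pa0 qa0.
ring.
Qed.
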